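(* Let $M^n\subset\mathbb{R}^{n+1}$ be a closed hypersurface. Then $$W^{l^\infty}_{n-1}(M^n)\leq 3^{\frac{1}{n}}\,\mathrm{vol}(M^n)^{\frac{1}{n}}\leq 3\,\mathrm{vol}(M^n)^{\frac{1}{n}}.$$
   Context: For $x\in\mathbb{R}^N$, $\Vert x\Vert_{l^\infty}=\max_i |x_i|$. For a closed manifold $M^n\subset\mathbb{R}^N$, its $l^\infty$-width $W^{l^\infty}_{n-1}(M^n)$ is the infimum, over all $(n-1)$-dimensional polyhedra $K^{n-1}\subset\mathbb{R}^N$ and all continuous maps $\phi:M^n\to K^{n-1}$, of $\sup_{x\in M^n}\Vert x-\phi(x)\Vert_{l^\infty}$. Here $\mathrm{vol}(M^n)$ is the $n$-dimensional Euclidean volume of $M^n$. *)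

(* Defs.v *)
From HB Require Import structures.
From mathcomp Require Import all_boot all_order all_algebra.
From mathcomp Require Import all_classical all_reals all_analysis.
Set Implicit Arguments. Unset Strict Implicit. Unset Printing Implicit Defensive.
Import Order.TTheory GRing.Theory Num.Theory.
Import numFieldNormedType.Exports.
Local Open Scope classical_set_scope.
Local Open Scope ring_scope.

Section Defs.
Variable R : realType.

Definition edist (N : nat) (x y : 'rV[R]_N) : R :=
  Num.sqrt (\sum_(i < N) (x ord0 i - y ord0 i) ^+ 2).

Definition linf (N : nat) (x : 'rV[R]_N) : R :=
  \big[Num.max/0]_(i < N) `|x ord0 i|.

(* Euclidean diameter (with the convention diam(empty) = 0) *)
Definition ediam (N : nat) (U : set 'rV[R]_N) : \bar R :=
  ereal_sup ([set (edist x y)%:E | x in U & y in U] `|` [set 0%E]).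

Fixpoint unit_ball_vol (n : nat) : R :=
  match n with
  | 0 => 1
  | 1 => 2
  | (m.+2) as k => 2 * pi / k%:R * unit_ball_vol m
  end.

Definition hausdorff_approx (N n : nat) (delta : R) (A : set 'rV[R]_N) : \bar R :=
  ereal_inf [set (\sum_(0 <= i <oo)
                   ((unit_ball_vol n)%:E * (ediam (U i) * (2^-1)%:E) ^+ n))%E
            | U in [set U : nat -> set 'rV[R]_N |
                     A `<=` \bigcup_i U i /\ forall i, (ediam (U i) <= delta%:E)%E]].

(* normalized n-dimensional Hausdorff measure = n-dim Euclidean volume *)
Definition hausdorff_measure (N n : nat) (A : set 'rV[R]_N) : \bar R :=
  ereal_sup [set hausdorff_approx n delta A | delta in [set d : R | 0 < d]].

Fixpoint Ck (n k : nat) (f : 'rV[R]_n -> R) : Prop :=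
  match k with
  | 0 => continuous f
  | k'.+1 => (forall x, differentiable f x) /\
             (forall v : 'rV[R]_n, Ck k' (fun x => 'D_v f x))
  end.
Definition smooth (n : nat) (f : 'rV[R]_n -> R) : Prop := forall k, Ck k f.

(* closed (compact, boundaryless) smooth embedded hypersurface of R^(n+1):
   compact, and locally the graph of a smooth function over a coordinate
   hyperplane *)
Definition closed_hypersurface (n : nat) (M : set 'rV[R]_n.+1) : Prop :=
  compact M /\
  forall p, M p -> exists (U : set 'rV[R]_n.+1) (i : 'I_n.+1) (g : 'rV[R]_n -> R),
    [/\ open U, U p, smooth g &
        M `&` U = [set x | U x /\ x ord0 i = g (col' i x)]].

(* a simplex of dimension <= d-1 : convex hull of d points *)
Definition simplex (N d : nat) (v : 'I_d -> 'rV[R]_N) : set 'rV[R]_N :=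
  [set x | exists t : 'I_d -> R, [/\ forall j, 0 <= t j, \sum_j t j = 1 &
                                   x = \sum_j t j *: v j]].

Definition polyhedron_dim_lt (N d : nat) (K : set 'rV[R]_N) : Prop :=
  exists (m : nat) (v : 'I_m -> 'I_d -> 'rV[R]_N),
    K = \bigcup_(k in [set: 'I_m]) simplex (v k).

Definition linf_width (N n : nat) (M : set 'rV[R]_N) : \bar R :=
  ereal_inf [set ereal_sup [set (linf (x - phi x))%:E | x in M]
            | phi in [set phi : 'rV[R]_N -> 'rV[R]_N |
                       exists K, polyhedron_dim_lt n K /\
                         {within M, continuous phi} /\ phi @` M `<=` K]].

End Defs.

(* Main.v *)
Require Import Defs.
From HB Require Import structures.
From mathcomp Require Import all_boot all_order all_algebra.
From mathcomp Require Import ring lra finmap zify.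
From mathcomp Require Import all_classical all_reals all_analysis.
Set Implicit Arguments. Unset Strict Implicit. Unset Printing Implicit Defensive.
Import Order.TTheory GRing.Theory Num.Theory.
Import numFieldNormedType.Exports.
Local Open Scope classical_set_scope.
Local Open Scope ring_scope.

(** Fix a cubical lattice of mesh [r] in R^(n+1). If [M] avoids the axis-parallel
    lines through the centers of the cells, then expanding every cell from its
    center by a large factor and clamping to the cell moves each point of [M] by
    at most [r / 2] in l^infty and pushes [M] into the (n-1)-skeleton. A lattice
    line in direction [i] meets [M] only if the shift of the lattice, with its
    [i]-th coordinate dropped, lies in the projection of [M] modulo [r]; hence a
    good shift exists as soon as the n+1 coordinate projections of [M] have total
    volume less than [r ^ n].

    Cover [M] by finitely many sets of diameters [d_k] with
    [sum omega_n (d_k / 2) ^ n] close to the volume. By the parallelogram law a set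
    of diameter [d] lies in a ball of radius about [sqrt 3 / 2 * d], so the
    projections have total volume at most [(n+1) * sqrt 3 ^ n * vol], which is at
    most [3 * 2 ^ n * vol], and [r / 2 = (3 vol) ^ (1/n)] is good enough up to an
    arbitrarily small error.

    The good shift is chosen one coordinate at a time, which replaces volumes in
    R^n by one-dimensional primitives of [(w - t ^ 2) ^ (m / 2)]. *)

(** * Antiderivatives with finitely many exceptional points, in place of integrals *)

Section Primitives.
Variable R : realType.
Implicit Types (h H : R -> R) (s : seq R).

(** Differences of [H] play the role of integrals of [h]. The list [s] holds the points, such as the
    two ends of a cap, where [H] may fail to be differentiable. *)
Definition primitive_off h H s :=
  continuous H /\ forall x, x \notin s -> is_derive x 1 H (h x).

Lemma primitive_off_growth h H s (K a b : R) : primitive_off h H s ->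
  a <= b -> (forall x, a <= x <= b -> K <= h x) -> K * (b - a) <= H b - H a.
Proof.
move=> [Hc Hd]; have := Hd.
have step (u v : R) : u <= v -> (forall x : R, x \in `]u, v[ -> is_derive x 1 H (h x)) ->
    (forall x, u <= x <= v -> K <= h x) -> K * (v - u) <= H v - H u.
  move=> uv HD Kh; have [->|neq] := eqVneq u v; first by rewrite !subrr mulr0.
  have ltuv : u < v by rewrite lt_neqAle neq.
  have [c cin ->] := MVT ltuv HD (continuous_subspaceT Hc).
  rewrite ler_wpM2r ?subr_ge0// Kh//.
  by move: cin; rewrite in_itv/= => /andP[/ltW -> /ltW ->].
(* Asking for the derivative only inside the open interval lets the induction drop the head [p] of
   [s]: either [p] lies outside, or the interval is cut at [p] and both halves are added. *)
suff key : forall s (a b : R),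
    (forall x : R, x \in `]a, b[ -> x \notin s -> is_derive x 1 H (h x)) ->
    a <= b -> (forall x, a <= x <= b -> K <= h x) -> K * (b - a) <= H b - H a.
  by move=> _; apply: (key s) => x _; exact: Hd.
elim=> [|p t IH] u v HD uv Kh; first by apply: step => // x xi; exact: HD.
have [pin|pout] := boolP (p \in `]u, v[); last first.
  apply: (IH u v) => // x xi xt; apply: HD => //; rewrite inE negb_or xt andbT.
  by apply: contraNneq pout => <-.
move: pin; rewrite in_itv/= => /andP[up pv].
have B1 x : u <= x <= p -> K <= h x.
  by move=> /andP[ux xp]; rewrite Kh// ux (le_trans xp (ltW pv)).
have B2 x : p <= x <= v -> K <= h x.
  by move=> /andP[px xv]; rewrite Kh// xv (le_trans (ltW up) px).
have D1 (x : R) : x \in `]u, p[ -> x \notin t -> is_derive x 1 H (h x).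
  rewrite in_itv/= => /andP[ux xp] xt; apply: HD.
    by rewrite in_itv/= ux (lt_trans xp pv).
  by rewrite inE negb_or xt andbT lt_eqF.
have D2 (x : R) : x \in `]p, v[ -> x \notin t -> is_derive x 1 H (h x).
  rewrite in_itv/= => /andP[px xv] xt; apply: HD.
    by rewrite in_itv/= xv (lt_trans up px).
  by rewrite inE negb_or xt andbT gt_eqF.
have I1 := IH u p D1 (ltW up) B1.
have I2 := IH p v D2 (ltW pv) B2.
rewrite -(subrKA p v) -(subrKA (H p) (H v)) mulrDr; exact: lerD.
Qed.

Lemma primitive_off_cst (c : R) : primitive_off (fun=> c) (fun t => c * t) [::].
Proof.
split=> [x|x _]; first by apply: cvgM; [exact: cvg_cst|exact: cvg_id].
have := @is_deriveZ _ _ _ id c x 1 _ (is_derive_id x 1).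
by rewrite -[_ *: _]/(c * 1) mulr1.
Qed.

Lemma primitive_offD h1 H1 s1 h2 H2 s2 :
  primitive_off h1 H1 s1 -> primitive_off h2 H2 s2 ->
  primitive_off (fun t => h1 t + h2 t) (fun t => H1 t + H2 t) (s1 ++ s2).
Proof.
move=> [c1 d1] [c2 d2]; split=> [x|x]; first by apply: cvgD; [exact: c1|exact: c2].
rewrite mem_cat negb_or => /andP[/d1 D1 /d2 D2]; exact: is_deriveD.
Qed.

Lemma primitive_offZ (c : R) h H s :
  primitive_off h H s -> primitive_off (fun t => c * h t) (fun t => c * H t) s.
Proof.
move=> [c1 d1]; split=> [x|x /d1 D1].
  by apply: cvgM; [exact: cvg_cst|exact: c1].
by have := @is_deriveZ _ _ _ H c x 1 _ D1.
Qed.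

Lemma primitive_off_shift (e : R) h H s : primitive_off h H s ->
  primitive_off (fun t => h (t + e)) (fun t => H (t + e)) [seq x - e | x <- s].
Proof.
move=> [c1 d1]; split=> [x|x xs].
  apply: (@continuous_comp _ _ _ (fun t => t + e) H); last exact: c1.
  by apply: cvgD; [exact: cvg_id|exact: cvg_cst].
have xes : x + e \notin s.
  apply: contra xs => xs; apply/mapP; exists (x + e) => //; by rewrite addrK.
have D := d1 _ xes.
have D2 : is_derive x 1 (fun t => t + e) 1.
  by apply: is_derive_eq; rewrite addr0.
have := @is_derive1_comp _ H (fun t => t + e) x _ _ D D2.
by rewrite mulr1.
Qed.

Lemma primitive_off_sum (I : Type) (l : seq I) (h H : I -> R -> R) :
  (forall i, exists s, primitive_off (h i) (H i) s) ->
  exists s, primitive_off (fun t => \sum_(i <- l) h i t)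
                          (fun t => \sum_(i <- l) H i t) s.
Proof.
move=> hH; elim: l => [|i l [s IH]].
  exists [::]; have := primitive_off_cst 0.
  by congr primitive_off; apply/funext => t; rewrite big_nil// mul0r.
have [s' ps'] := hH i; exists (s' ++ s).
have := primitive_offD ps' IH.
by congr primitive_off; apply/funext => t; rewrite big_cons.
Qed.

End Primitives.

(** * Antiderivatives of the powers of [sqrt (1 - t^2)] *)

Section CapIntegral.
Variable R : realType.

Let q (t : R) : R := Num.sqrt (1 - t ^+ 2).

(* A primitive of [q ^ m] on [[-1, 1]]. The arcsine is written with [atan] so that the
   primitive is continuous up to the endpoints. *)
Fixpoint cap_prim (m : nat) (t : R) : R :=
  match m with
  | 0 => t
  | 1 => (t * q t + 2 * atan (t / (1 + q t))) / 2
  | m'.+2 as k => (t * q t ^+ k + k%:R * cap_prim m' t) / k.+1%:R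
  end.

Lemma cap_primSS m (t : R) :
  cap_prim m.+2 t = (t * q t ^+ m.+2 + m.+2%:R * cap_prim m t) / m.+3%:R.
Proof. by []. Qed.

Lemma nat_ind2 (P : nat -> Prop) :
  P 0%N -> P 1%N -> (forall m, P m -> P m.+2) -> forall m, P m.
Proof.
move=> P0 P1 PS m; suff [] : P m /\ P m.+1 by [].
by elim: m => [|m [? ?]]; split=> //; apply: PS.
Qed.

Let q_ge0 (t : R) : 0 <= q t. Proof. exact: sqrtr_ge0. Qed.

Let q_cont : continuous q.
Proof.
move=> t; apply: (@continuous_comp _ _ _ (fun t : R => 1 - t ^+ 2) Num.sqrt).
  apply: cvgB; [exact: cvg_cst|exact: exprn_continuous].
exact: sqrt_continuous.
Qed.

Let q_derive (t : R) : `|t| < 1 -> is_derive t 1 q (- t / q t).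
Proof.
move=> t1; have tpos : 0 < 1 - t ^+ 2.
  by rewrite subr_gt0 -real_normK ?num_real// expr_lt1.
have D1 : is_derive t 1 (fun t : R => 1 - t ^+ 2) (- (2 * t)).
  by apply: is_derive_eq; rewrite -![_ *: _]/(_ * _); ring.
have D2 := is_derive1_sqrt tpos.
have := @is_derive1_comp _ Num.sqrt (fun t : R => 1 - t ^+ 2) t _ _ D2 D1.
congr is_derive; rewrite -/(q t).
have : q t != 0 by rewrite gt_eqF// sqrtr_gt0.
by move=> ?; field.
Qed.

Lemma cap_prim_continuous m : continuous (cap_prim m).
Proof.
elim/nat_ind2: m => [x|x|m IH x].
- exact: cvg_id.
- apply: cvgM; last exact: cvg_cst.
  apply: cvgD; first by apply: cvgM; [exact: cvg_id|exact: q_cont].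
  apply: cvgM; first exact: cvg_cst.
  apply: continuous_cvg; first exact: continuous_atan.
  apply: cvgM; first exact: cvg_id.
  apply: cvgV; first by rewrite gt_eqF// ltr_wpDr.
  by apply: cvgD; [exact: cvg_cst|exact: q_cont].
- apply: cvgM; last exact: cvg_cst.
  apply: cvgD.
    apply: cvgM; first exact: cvg_id.
    apply: (@continuous_cvg _ _ _ _ _ q (fun y => y ^+ m.+2)).
      exact: exprn_continuous.
    exact: q_cont.
  by apply: cvgM; [exact: cvg_cst|exact: IH].
Qed.

(** Integration by parts: [(t q^k)' = (k+1) q^k - k q^(k-2)], which is the recursion of [cap_prim]
    with [k = m+2]. For [m = 1], [t / (1 + q)] is the tangent of half the arcsine of [t]. *)
Lemma cap_prim_derive m (t : R) : `|t| < 1 ->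
  is_derive t 1 (cap_prim m) (Num.sqrt (1 - t ^+ 2) ^+ m).
Proof.
move=> t1; have Dq := q_derive t1; rewrite -/(q t).
have tpos : 0 < 1 - t ^+ 2.
  by rewrite subr_gt0 -real_normK ?num_real// expr_lt1.
have qpos : 0 < q t by rewrite sqrtr_gt0.
have q2 : q t ^+ 2 = 1 - t ^+ 2 by rewrite sqr_sqrtr// ltW.
have t2 : t ^+ 2 = 1 - q t ^+ 2 by rewrite q2; ring.
elim/nat_ind2: m => [||m IH].
- by rewrite expr0; exact: is_derive_id.
- have q10 : 1 + q t != 0 by rewrite gt_eqF// addr_gt0.
  have D1 : is_derive t 1 (fun t => t / (1 + q t)) (q t * (1 + q t))^-1.
    have D2 : is_derive t 1 (fun t => 1 + q t) (- t / q t).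
      have := @is_deriveD _ _ _ _ _ _ _ _ _ (is_derive_cst (1 : R) t 1) Dq.
      by rewrite add0r.
    have D3 := @is_deriveV _ (fun t => 1 + q t) _ _ _ q10 D2.
    have := is_deriveM (is_derive_id t 1) D3.
    congr is_derive; rewrite -![_ *: _]/(_ * _).
    have qn0 : q t != 0 by rewrite gt_eqF.
    transitivity ((t ^+ 2 + q t + q t ^+ 2) / (q t * (1 + q t) ^+ 2)).
      by rewrite /=; field; rewrite qn0 q10.
    by rewrite t2; field; rewrite qn0 q10.
  have D2 := @is_derive1_comp _ atan _ _ _ _ (is_derive1_atan _) D1.
  have D3 := is_deriveM (is_derive_id t 1) Dq.
  have D4 := is_deriveZ 2 D2.
  have D5 := is_deriveZ 2^-1 (is_deriveD D3 D4).
  have -> : cap_prim 1 = (fun t => 2^-1 * (t * q t + 2 * atan (t / (1 + q t)))).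
    by apply/funext => x /=; rewrite mulrC.
  move: D5; congr is_derive; rewrite -![_ *: _]/(_ * _) expr1 /=.
  have qn0 : q t != 0 by rewrite gt_eqF.
  have den : (1 + q t) ^+ 2 + t ^+ 2 = 2 * (1 + q t) by rewrite t2; ring.
  have -> : (1 + (t / (1 + q t)) ^+ 2)^-1 = (1 + q t) / 2.
    have -> : 1 + (t / (1 + q t)) ^+ 2 = ((1 + q t) ^+ 2 + t ^+ 2) / (1 + q t) ^+ 2.
      by field.
    by rewrite den; field; rewrite q10.
  transitivity ((q t ^+ 2 - t ^+ 2 + 1) / (2 * q t)).
    by field; rewrite qn0 q10.
  by rewrite t2; field.
- have D1 := is_deriveX m.+2 Dq; rewrite exprfctE in D1.
  have D2 := is_deriveM (is_derive_id t 1) D1.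
  have D3 := is_deriveZ m.+2%:R IH.
  have D4 := is_deriveZ m.+3%:R^-1 (is_deriveD D2 D3).
  have -> : cap_prim m.+2 =
      (fun t => m.+3%:R^-1 * (t * q t ^+ m.+2 + m.+2%:R * cap_prim m t)).
    by apply/funext => x; rewrite cap_primSS mulrC.
  move: D4; congr is_derive; rewrite -![_ *: _]/(_ * _) /=.
  have qn0 : q t != 0 by rewrite gt_eqF.
  have m0 : m.+3%:R != 0 :> R by rewrite pnatr_eq0.
  transitivity (q t ^+ m * (q t ^+ 2 + m.+2%:R * (1 - t ^+ 2)) / m.+3%:R).
    by rewrite !exprS; move: m0; move: m.+3%:R m.+2%:R => M3 M2 m0; field; rewrite qn0 m0.
  move: m0; rewrite t2 !exprS -[m.+3%:R]natr1; move: m.+2%:R => M2 m0; by field.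
Qed.

End CapIntegral.

(** * Ball volumes by slicing, and the total mass of a cap *)

Section CapValues.
Variable R : realType.

Lemma cap_primN m (t : R) : cap_prim m (- t) = - cap_prim m t.
Proof.
elim/nat_ind2: m => [|/=|m IH] //.
  by rewrite sqrrN !mulNr atanN; field.
by rewrite !cap_primSS IH sqrrN mulrN mulNr -opprD mulNr.
Qed.

(** Wallis' product: the boundary term vanishes at 1, so each step multiplies the product by
    [(m+2) / (m+3)]. *)
Lemma cap_prim_at1 m : cap_prim m.+1 (1 : R) * cap_prim m (1 : R) = pi / (2 * m.+2%:R) :> R.
Proof.
have z : Num.sqrt (1 - 1 ^+ 2) = 0 :> R by rewrite expr1n subrr sqrtr0.
elim: m => [|m IH]; first by rewrite /= z addr0 divr1 atan1; field.
rewrite cap_primSS z expr0n [(m.+2 == 0)%N]/= mulr0 add0r.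
transitivity (m.+2%:R / m.+3%:R * (cap_prim m.+1 (1 : R) * cap_prim m (1 : R))); first by ring.
rewrite IH.
have : m.+2%:R != 0 :> R by rewrite pnatr_eq0.
have : m.+3%:R != 0 :> R by rewrite pnatr_eq0.
by move: m.+2%:R m.+3%:R => a b a0 b0; field; rewrite a0 b0.
Qed.

(** Slicing the ball by parallel hyperplanes. The Wallis product reconciles this one-step recursion
    with the two-step definition. *)
Lemma unit_ball_volS m :
  unit_ball_vol R m.+1 = 2 * cap_prim m (1 : R) * unit_ball_vol R m.
Proof.
elim: m => [|m IH]; first by rewrite /= !mulr1.
rewrite -[LHS]/(2 * pi / m.+2%:R * unit_ball_vol R m) IH.
transitivity (4 * (cap_prim m.+1 (1 : R) * cap_prim m (1 : R)) * unit_ball_vol R m);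
  last by ring.
rewrite cap_prim_at1; have : m.+2%:R != 0 :> R by rewrite pnatr_eq0.
by move: m.+2%:R => a a0; field.
Qed.

(** For [h >= 0], the nearest-point projection onto [[-h, h]]; this closed form makes continuity
    immediate. *)
Definition clamp (h x : R) := (`|x + h| - `|x - h|) / 2.

Lemma clamp_id h x : `|x| <= h -> clamp h x = x.
Proof.
rewrite ler_norml => /andP[a b]; rewrite /clamp ger0_norm; last by lra.
by rewrite ler0_norm; lra.
Qed.

Lemma clamp_ge h x : 0 <= h -> h <= x -> clamp h x = h.
Proof. by move=> h0 hx; rewrite /clamp !ger0_norm; lra. Qed.

Lemma clamp_le h x : 0 <= h -> x <= - h -> clamp h x = - h.
Proof. by move=> h0 hx; rewrite /clamp !ler0_norm; lra. Qed.

Lemma clamp_continuous h : continuous (clamp h).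
Proof.
move=> x; apply: cvgM; last exact: cvg_cst.
by apply: cvgB; apply: cvg_norm; [apply: cvgD|apply: cvgB];
  (exact: cvg_id || exact: cvg_cst).
Qed.

(** Up to the factor [unit_ball_vol m], the section at height [t] of an [(m+1)]-ball of squared
    radius [w]. The indicator matters for [m = 0], where the power is 1 even outside the ball. *)
Definition cap_density m (w t : R) := (t ^+ 2 < w)%R%:R * Num.sqrt (w - t ^+ 2) ^+ m.

Definition cap_mass m (w t : R) :=
  Num.sqrt w ^+ m.+1 * cap_prim m (clamp 1 (t / Num.sqrt w)).

(** Inside the ball this is [cap_prim] rescaled by [sqrt w]; outside, the clamp makes [cap_mass]
    locally constant. Only the two ends [sqrt w] and [- sqrt w] are exceptional. *)
Lemma cap_mass_primitive m (w : R) :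
  exists s, primitive_off (cap_density m w) (cap_mass m w) s.
Proof.
have [w0|w0] := leP w 0.
  exists [::]; have := primitive_off_cst (0 : R); congr primitive_off; apply/funext => t.
    by rewrite /cap_density ltNge (le_trans w0 (sqr_ge0 t))/= mul0r.
  by rewrite /cap_mass ler0_sqrtr// expr0n !mul0r.
set r : R := Num.sqrt w; have r0 : 0 < r by rewrite sqrtr_gt0.
have rn0 : r != 0 by rewrite gt_eqF.
have r2 : r ^+ 2 = w by rewrite sqr_sqrtr// ltW.
exists [:: r; - r]; split.
  move=> x; apply: cvgM; first exact: cvg_cst.
  apply: (@continuous_cvg _ _ _ _ _ _ (cap_prim m)); first exact: cap_prim_continuous.
  apply: (@continuous_cvg _ _ _ _ _ _ (clamp 1)); first exact: clamp_continuous.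
  by apply: cvgM; [exact: cvg_id|exact: cvg_cst].
move=> x; rewrite !inE negb_or => /andP[xr xNr].
have [xlt|] := ltP `|x| r.
  rewrite /cap_density -r2 -[x ^+ 2]real_normK ?num_real// ltr_pXn2r ?nnegrE// ?ltW// xlt mul1r.
  rewrite real_normK ?num_real//.
  have x1 : `|x / r| < 1 by rewrite normrM normfV (gtr0_norm r0) ltr_pdivrMr// mul1r.
  have D := cap_prim_derive m x1.
  have D1 : is_derive x 1 (fun t => t / r) r^-1.
    by have := is_deriveZ r^-1 (is_derive_id x 1); rewrite -[_ *: _]/(_ * _) mulr1;
      congr is_derive; apply/funext => t; rewrite mulrC.
  have D2 := is_deriveZ (r ^+ m.+1) (@is_derive1_comp _ _ (fun t => t / r) _ _ _ D D1).
  have D3 : is_derive x 1 (fun t : R => r ^+ m.+1 * cap_prim m (t / r))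
      (Num.sqrt (r ^+ 2 - x ^+ 2) ^+ m).
    move: D2; congr is_derive; rewrite -[_ *: _]/(_ * _).
    have -> : r ^+ 2 - x ^+ 2 = r ^+ 2 * (1 - (x / r) ^+ 2) by field.
    rewrite sqrtrM ?sqr_ge0// sqrtr_sqr (gtr0_norm r0) [(r * _) ^+ m]exprMn [r ^+ m.+1]exprS.
    by move: (Num.sqrt _ ^+ m) => S; field.
  rewrite r2 in D3 *; refine (near_eq_is_derive _ D3).
  near=> t; rewrite /cap_mass clamp_id// ltW// normrM normfV (gtr0_norm r0).
  rewrite ltr_pdivrMr// mul1r; near: t.
  have : nbhs `|x| [set y : R | y < r] by exact: lt_nbhsl.
  exact: norm_continuous.
move=> rx.
have rx' : r < `|x|.
  rewrite lt_neqAle rx andbT; apply: contra xr => /eqP rxE.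
  move: xNr; rewrite rxE; case: (ger0P x) => _; rewrite ?eqxx// opprK eqxx//.
have -> : cap_density m w x = 0.
  rewrite /cap_density ltNge -r2 -[x ^+ 2]real_normK ?num_real//.
  by rewrite lerXn2r ?nnegrE ?(ltW r0)// mul0r.
refine (near_eq_is_derive _ (is_derive_cst (cap_mass m w x) x 1)).
have [x0|x0] := ltP 0 x.
  move: rx'; rewrite gtr0_norm// => rx'.
  near=> t; have rt : r < t by near: t; exact: lt_nbhsr.
  by rewrite /cap_mass !(@clamp_ge 1)// ler_pdivlMr// mul1r ltW.
move: rx'; rewrite ler0_norm// => rx'.
near=> t; have rt : t < - r by near: t; apply: lt_nbhsl; lra.
by rewrite /cap_mass -/r !(@clamp_le 1)// ler_pdivrMr// mulN1r ?ltW// ltrNr.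
Unshelve. all: by end_near. Qed.

Lemma cap_density_ge0 m (w t : R) : 0 <= cap_density m w t.
Proof. by rewrite mulr_ge0// exprn_ge0// sqrtr_ge0. Qed.

(** The mass is monotone since its density is nonnegative, so both ends can be pushed out of the
    ball, where the clamp saturates. *)
Lemma cap_mass_total m (w x y : R) : x <= y ->
  cap_mass m w y - cap_mass m w x <= 2 * cap_prim m (1 : R) * Num.sqrt w ^+ m.+1.
Proof.
have [w0|w0] := leP w 0; first by rewrite /cap_mass ler0_sqrtr// expr0n !mul0r mulr0 subrr.
set r : R := Num.sqrt w; have r0 : 0 < r by rewrite sqrtr_gt0.
have [s ps] := cap_mass_primitive m w.
have mono u v : u <= v -> cap_mass m w u <= cap_mass m w v.
  move=> uv; rewrite -subr_ge0 -[X in X <= _](mul0r (v - u)).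
  by apply: (primitive_off_growth (K := 0) ps uv) => t _; exact: cap_density_ge0.
move=> _.
have U : cap_mass m w y <= r ^+ m.+1 * cap_prim m (1 : R).
  apply: (le_trans (mono y (Num.max y r) _)); first by rewrite le_max lexx.
  rewrite /cap_mass clamp_ge// ler_pdivlMr// mul1r le_max lexx orbT//.
have L : - (r ^+ m.+1 * cap_prim m (1 : R)) <= cap_mass m w x.
  apply: (le_trans _ (mono (Num.min x (- r)) x _)); last by rewrite ge_min lexx.
  rewrite /cap_mass clamp_le ?cap_primN ?mulrN//.
  by rewrite ler_pdivrMr// mulN1r ge_min lexx orbT.
lra.
Qed.

End CapValues.

(** * Choosing the lattice shift one coordinate at a time *)

Section Avoidance.
Variables (R : realType) (r A : R) (P : nat).
Hypothesis r0 : 0 < r.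

(* Center, squared radius, and the coordinates entering the distance. *)
Definition cylinder := ((nat -> R) * R * (nat -> bool))%type.

Let ndir N (k : cylinder) : nat := count k.2 (iota 0 N).

(** The volume of a [q]-ball relative to a cube of side [r]. The indicator makes an empty ball count
    0 also for [q = 0]. *)
Definition potential q (w : R) : R :=
  (0 < w)%R%:R * (unit_ball_vol R q * Num.sqrt w ^+ q) / r ^+ q.

(** What remains of a cylinder once coordinate [N] of the shift is [t]: one smaller ball per lattice
    translate. A nonpositive squared radius means that the translate misses the open ball. *)
Definition slice N (t : R) (k : cylinder) : seq cylinder :=
  if k.2 N
  then [seq (k.1.1, k.1.2 - (t + r * z%:R - k.1.1 N) ^+ 2, k.2) | z <- index_iota 0 P]
  else [:: k].

Lemma unit_ball_vol_ge0 q : 0 <= unit_ball_vol R q.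
Proof.
elim/nat_ind2: q => [||q IH]; [exact: ler01|exact: ler0n|].
by rewrite /= mulr_ge0// divr_ge0// mulr_ge0// pi_ge0.
Qed.

Lemma potential_ge0 q w : 0 <= potential q w.
Proof.
by rewrite divr_ge0 ?exprn_ge0 ?(ltW r0)// !mulr_ge0 ?unit_ball_vol_ge0 ?exprn_ge0 ?sqrtr_ge0.
Qed.

(** The [P] translates of one period tile a long interval, so the integrals telescope to a single
    one, bounded by the total cap mass; [unit_ball_volS] identifies that bound. *)
Lemma slice_potential N (k : cylinder) : exists H : R -> R,
  (exists s, primitive_off
     (fun t => \sum_(k' <- slice N t k) potential (ndir N k') k'.1.2) H s) /\
  H (A + r) - H A <= r * potential (ndir N.+1 k) k.1.2.
Proof.
case: k => [[c w] b]; rewrite /slice /ndir -[N.+1]addn1 iotaD count_cat/= add0n addn0.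
set q := count b (iota 0 N); case: (b N); last first.
  exists (fun t => potential q w * t); split.
    exists [::]; have := primitive_off_cst (potential q w).
    by congr primitive_off; apply/funext => t; rewrite big_seq1.
  by rewrite addn0 mulrDr addrAC subrr add0r mulrC.
set K := unit_ball_vol R q / r ^+ q.
exists (fun t => \sum_(0 <= z < P) K * cap_mass q w (t + (r * z%:R - c N))); split.
  have [s ps] := @primitive_off_sum R _ (index_iota 0 P)
    (fun z t => K * cap_density q w (t + (r * z%:R - c N)))
    (fun z t => K * cap_mass q w (t + (r * z%:R - c N)))
    (fun z => let: ex_intro s ps := cap_mass_primitive q w in
       ex_intro _ _ (primitive_offZ K (primitive_off_shift (r * z%:R - c N) ps))).
  exists s; move: ps; congr primitive_off; apply/funext => t.
  rewrite big_map; apply: eq_bigr => z _.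
  rewrite /potential/= /cap_density subr_gt0 addrA /K -/q; ring.
rewrite -sumrB.
rewrite (eq_bigr (fun z => K * cap_mass q w (A + r * z.+1%:R - c N) -
                           K * cap_mass q w (A + r * z%:R - c N))); last first.
  move=> z _; rewrite -natr1 mulrDr mulr1.
  by congr (K * cap_mass _ _ _ - K * cap_mass _ _ _); ring.
rewrite telescope_sumr// -mulrBr.
have K0 : 0 <= K by rewrite divr_ge0 ?unit_ball_vol_ge0// exprn_ge0// ltW.
apply: (le_trans (ler_wpM2l K0 (cap_mass_total _ _ _))).
  by rewrite lerB// lerD2l ler_wpM2l// ?ler_nat// ltW.
rewrite /potential addn1 unit_ball_volS /K.
have [w0|w0] := leP w 0; first by rewrite ler0_sqrtr// expr0n/= !mulr0 !mul0r mulr0.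
rewrite mul1r le_eqVlt; apply/orP; left; apply/eqP.
have rn0 : r != 0 by rewrite gt_eqF.
by rewrite [r ^+ q.+1]exprS; field; rewrite rn0 expf_neq0.
Qed.

(** Averaging: if every [t] in the period gave at least 1, the primitive would grow by at least [r],
    but it grows by at most [r] times the old potential. *)
Lemma exists_slice N (l : seq cylinder) :
  \sum_(k <- l) potential (ndir N.+1 k) k.1.2 < 1 ->
  exists t, A <= t <= A + r /\
    \sum_(k <- flatten [seq slice N t k | k <- l]) potential (ndir N k) k.1.2 < 1.
Proof.
move=> l1; apply: contrapT => noT.
have [H HP] := choice (slice_potential N).
have [s ps] := primitive_off_sum l (fun k => (HP k).1).
have ge1 t : A <= t <= A + r ->
    1 <= \sum_(k <- l) \sum_(k' <- slice N t k) potential (ndir N k') k'.1.2.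
  move=> tA; rewrite leNgt; apply/negP => lt1; apply: noT; exists t; split=> //.
  by rewrite big_flatten big_map.
have Ar : A <= A + r by rewrite lerDl ltW.
have := primitive_off_growth (K := 1) ps Ar ge1.
rewrite mul1r addrAC subrr add0r -sumrB => rle.
have : r <= r * \sum_(k <- l) potential (ndir N.+1 k) k.1.2.
  rewrite mulr_sumr; apply: (le_trans rle); apply: ler_sum => k _; exact: (HP k).2.
by rewrite -[X in X <= _]mulr1 ler_pM2l// leNgt l1.
Qed.

(* The method of conditional expectations: the potential of a cylinder is the
   measure of the shifts that hit it, and each coordinate of the shift is
   chosen so as not to increase the total. *)
Lemma exists_avoiding_shift N (l : seq cylinder) :
  \sum_(k <- l) potential (ndir N k) k.1.2 < 1 ->
  exists a : nat -> R, (forall j, A <= a j <= A + r) /\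
    forall k, k \in l -> forall z : nat -> nat, (forall j, (z j < P)%N) ->
      k.1.2 <= \sum_(j < N | k.2 j) (a j + r * (z j)%:R - k.1.1 j) ^+ 2.
Proof.
elim: N l => [|N IH] l l1.
  exists (fun=> A); split=> [j|k kl z _]; first by rewrite lexx lerDl ltW.
  rewrite big_ord0 leNgt; apply/negP => w0; move: l1; rewrite ltNge => /negP; apply.
  (* With no coordinate left, a ball of positive squared radius has potential exactly 1, which the
     bound on the sum excludes. *)
  have pk : potential (ndir 0 k) k.1.2 = 1 by rewrite /potential w0 mul1r mul1r expr0 divr1.
  rewrite (big_rem k)// pk lerDl.
  by apply: sumr_ge0 => i _; exact: potential_ge0.
have [t [tA /IH[a [aA av]]]] := exists_slice l1.
exists (fun j => if (j < N)%N then a j else t); split=> [j|k kl z zP]; first by case: ifP.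
rewrite big_mkcond big_ord_recr/= ltnn.
have -> : \sum_(i < N) (if k.2 i then ((if (i < N)%N then a i else t) + r * (z i)%:R
      - k.1.1 i) ^+ 2 else 0) =
    \sum_(i < N | k.2 i) (a i + r * (z i)%:R - k.1.1 i) ^+ 2.
  by rewrite [RHS]big_mkcond/=; apply: eq_bigr => i _; rewrite ltn_ord.
case: ifPn => kN; last first.
  rewrite addr0; apply: av => //; apply/flatten_mapP; exists k => //.
  by rewrite /slice (negbTE kN) mem_head.
rewrite -lerBlDr.
apply: (av (k.1.1, k.1.2 - (t + r * (z N)%:R - k.1.1 N) ^+ 2, k.2)) => //.
apply/flatten_mapP; exists k => //; rewrite /slice kN; apply/mapP.
by exists (z N); rewrite ?mem_index_iota ?zP.
Qed.

End Avoidance.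

(** * Crushing a single coordinate towards the cell walls *)

Section Crush.
Variables (R : realType) (h lam : R).

(* For [y] in [[2hm - h, 2hm + h]] with [m <= p] this is
   [2hm + clamp h (lam * (y - 2hm))]. *)
Definition crush p (y : R) : R :=
  h * p%:R + \sum_(0 <= z < p.+1) clamp h (lam * (y - 2 * h * z%:R)).

Lemma clamp_bounds x (h0 : 0 < h) : - h <= clamp h x <= h.
Proof.
have [hx|xh] := leP h x; first by rewrite clamp_ge; lra.
have [hx|xh'] := leP x (- h); first by rewrite clamp_le; lra.
by rewrite clamp_id ?ler_norml; lra.
Qed.

(** Both points lie on the same side of 0 within [[-h, h]]. *)
Lemma clamp_scale_near x (h0 : 0 < h) (lam1 : 1 <= lam) :
  `|x| <= h -> `|clamp h (lam * x) - x| <= h.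
Proof.
rewrite !ler_norml => /andP[hx xh]; have /andP[b1 b2] := clamp_bounds (lam * x) h0.
have [x0|x0] := leP 0 x.
  have lx : x <= lam * x by rewrite ler_peMl.
  suff : 0 <= clamp h (lam * x) by lra.
  have [hlx|lxh] := leP h (lam * x); first by rewrite clamp_ge; lra.
  by rewrite clamp_id ?ler_norml; lra.
have lx : lam * x <= x by rewrite ler_neMl// ltW.
suff : clamp h (lam * x) <= 0 by lra.
have [hlx|lxh] := leP (lam * x) (- h); first by rewrite clamp_le; lra.
by rewrite clamp_id ?ler_norml; lra.
Qed.

Lemma clamp_scale_ge x (h0 : 0 < h) (lam1 : 1 <= lam) : h <= x -> clamp h (lam * x) = h.
Proof.
move=> hx; rewrite clamp_ge ?(ltW h0)//; apply: (le_trans hx).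
by rewrite ler_peMl// (le_trans (ltW h0)).
Qed.

Lemma clamp_scale_le x (h0 : 0 < h) (lam1 : 1 <= lam) : x <= - h -> clamp h (lam * x) = - h.
Proof.
move=> hx; rewrite clamp_le ?(ltW h0)//; apply: (le_trans _ hx).
by rewrite ler_neMl//; lra.
Qed.

Lemma crush_near p y (h0 : 0 < h) (lam1 : 1 <= lam) :
  0 <= y <= 2 * h * p%:R -> `|crush p y - y| <= h.
Proof.
(* The saturated value beyond the last cell is carried along for the induction. Left of a new cell
   its clamp is [-h] and cancels the added [h]; further right, the earlier cells are saturated. *)
suff [near _] : (- h <= y <= 2 * h * p%:R + h -> `|crush p y - y| <= h) /\
    (2 * h * p%:R + h <= y -> crush p y = 2 * h * p%:R + h).
  by move=> /andP[y0 yp]; apply: near; lra.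
elim: p => [|p [IH1 IH2]].
  rewrite /crush big_nat1 !mulr0 subr0 !add0r; split=> hy.
    by apply: clamp_scale_near => //; rewrite ler_norml.
  exact: clamp_scale_ge.
have rec : crush p.+1 y = crush p y + h + clamp h (lam * (y - 2 * h * p.+1%:R)).
  by rewrite /crush [in LHS]big_nat_recr//=; ring.
have pE : 2 * h * p.+1%:R = 2 * h * p%:R + 2 * h by rewrite -natr1; ring.
rewrite rec pE; have [ylt|ygt] := leP y (2 * h * p%:R + h).
  rewrite clamp_scale_le//; last by lra.
  rewrite addrK; split=> hy; last by lra.
  by apply: IH1; lra.
rewrite IH2 ?(ltW ygt)//; split=> hy; last by rewrite clamp_scale_ge//; lra.
have -> : 2 * h * p%:R + h + h + clamp h (lam * (y - (2 * h * p%:R + 2 * h))) - y =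
    clamp h (lam * (y - (2 * h * p%:R + 2 * h))) - (y - (2 * h * p%:R + 2 * h)) by ring.
by apply: clamp_scale_near => //; rewrite ler_norml; lra.
Qed.

(** All [p+1] clamps are saturated, and [c] counts those equal to [-h], hence its [p+2] possible
    values. *)
Lemma crush_grid p y (h0 : 0 < h) :
  (forall z, (z < p.+1)%N -> h <= `|lam * (y - 2 * h * z%:R)|) ->
  exists2 c, (c < p.+2)%N & crush p y = h * p%:R + h * p.+1%:R - 2 * h * c%:R.
Proof.
move=> far; rewrite /crush.
have : forall q, (q <= p.+1)%N -> exists2 c, (c <= q)%N &
    \sum_(0 <= z < q) clamp h (lam * (y - 2 * h * z%:R)) = h * q%:R - 2 * h * c%:R.
  elim=> [|q IH] qp; first by exists 0%N => //; rewrite big_geq// !mulr0 subr0.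
  have [c cq E] := IH (ltnW qp); rewrite big_nat_recr//= E -[q.+1%:R]natr1.
  have := far q qp; case: (ger0P (lam * _)) => [_ far'|_ far'].
    by exists c; [exact: leqW|rewrite clamp_ge ?(ltW h0)//; ring].
  exists c.+1 => //; rewrite clamp_le ?(ltW h0)//; last by lra.
  by rewrite -natr1; ring.
by move=> /(_ p.+1 (leqnn _))[c cp ->]; exists c => //; rewrite addrA.
Qed.

Lemma crush_continuous p : continuous (crush p).
Proof.
move=> y; apply: cvgD; first exact: cvg_cst.
apply: cvg_big => [|z _]; first exact: add_continuous.
apply: (@continuous_cvg _ _ _ _ _ _ (clamp h)); first exact: clamp_continuous.
apply: cvgM; first exact: cvg_cst.
by apply: cvgB; [exact: cvg_id|exact: cvg_cst].
Qed.

End Crush.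

(** * The width bound for a lattice whose center lines stay away from [M] *)

Section Width.
Variable R : realType.

(* A simplex in the flat where the two coordinates [j1] and [lift j1 l0] are fixed,
   large enough to contain all points of that flat with coordinates in [[-B, B]]. *)
Definition flat_simplex n (B : R) (j1 : 'I_n.+1) (l0 : 'I_n) (al be : R) (l : 'I_n)
    : 'rV[R]_n.+1 :=
  \row_j (if j == j1 then al else if j == lift j1 l0 then be
          else - B + (j == lift j1 l)%:R * (2 * B * n%:R)).

Lemma mem_flat_simplex n (B : R) (j1 : 'I_n.+1) (l0 : 'I_n) (x : 'rV[R]_n.+1) :
  0 < B -> (forall j, `|x ord0 j| <= B) ->
  simplex (flat_simplex B j1 l0 (x ord0 j1) (x ord0 (lift j1 l0))) x.
Proof.
move=> B0 xB; have n0 : (0 < n)%N by case: n l0 {j1 x xB} => [[]|].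
have S0 : 0 < 2 * B * n%:R by rewrite !mulr_gt0// ltr0n.
pose u l := (x ord0 (lift j1 l) + B) / (2 * B * n%:R).
have u0 l : 0 <= u l.
  by rewrite divr_ge0 ?(ltW S0)//; have := xB (lift j1 l); rewrite ler_norml; lra.
have u1 l : u l <= n%:R^-1.
  rewrite ler_pdivrMr// mulrCA mulVf ?pnatr_eq0 -?lt0n// mulr1.
  by have := xB (lift j1 l); rewrite ler_norml; lra.
(* Each free coordinate determines its own barycentric weight, at most [1/n]; the corner vertex [l0]
   takes the remainder, nonnegative because only [n-1] weights are subtracted. *)
pose t l := if l == l0 then 1 - \sum_(l' | l' != l0) u l' else u l.
have sum_t : \sum_l t l = 1.
  rewrite (bigD1 l0)//= /t eqxx.
  rewrite [X in _ + X](eq_bigr u) ?subrK// => l /negbTE -> //.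
exists t; split=> //.
- move=> l; rewrite /t; case: eqP => // _; rewrite subr_ge0.
  apply: (@le_trans _ _ (\sum_(l' < n) n%:R^-1)).
    rewrite [X in _ <= X](bigD1 l0)//= ler_wpDl ?invr_ge0// ler_sum// => l' _; exact: u1.
  by rewrite sumr_const card_ord -[_ *+ _]mulr_natr mulVf// pnatr_eq0 -lt0n.
- apply/rowP => j; rewrite summxE.
  under eq_bigr do rewrite !mxE.
  have [->|jj1] := eqVneq j j1; first by rewrite -mulr_suml sum_t mul1r.
  have [->|jl0] := eqVneq j (lift j1 l0); first by rewrite -mulr_suml sum_t mul1r.
  under eq_bigr do rewrite mulrDr.
  rewrite big_split/= -mulr_suml sum_t mul1r.
  case: (unliftP j1 j) jj1 jl0 => [l1 -> _ jl0|-> /eqP//].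
  have l10 : l1 != l0 by apply: contraNneq jl0 => ->.
  rewrite (bigD1 l1)//= eqxx mul1r big1 => [|l ll1]; last first.
    by rewrite (inj_eq lift_inj) eq_sym (negbTE ll1) mul0r mulr0.
  rewrite /t (negbTE l10) /u mulfVK ?gt_eqF//; ring.
Qed.

Lemma polyhedron_finType (N d : nat) (T : finType) (v : T -> 'I_d -> 'rV[R]_N) :
  polyhedron_dim_lt d (\bigcup_(k in [set: T]) simplex (v k)).
Proof.
exists #|T|, (fun k => v (enum_val k)); apply/seteqP; split=> x [k _ kx].
  by exists (enum_rank k) => //; rewrite enum_rankK.
by exists (enum_val k).
Qed.

Lemma continuous_row (T : topologicalType) n (f : 'I_n -> T -> R) :
  (forall j, continuous (f j)) -> continuous (fun x => \row_j f j x : 'rV[R]_n).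
Proof.
move=> fc x.
have -> : (fun x => \row_j f j x : 'rV[R]_n) =
    (fun x => \sum_j f j x *: (delta_mx 0 j : 'rV[R]_n)).
  by apply/funext => y; rewrite [LHS]row_sum_delta; apply: eq_bigr => j _; rewrite mxE.
apply: cvg_big => [|j _]; first exact: add_continuous.
by apply: cvgZr_tmp; exact: fc.
Qed.

Lemma linf_width_le_shift n (M : set 'rV[R]_n.+1) (h lam : R) (a : 'I_n.+1 -> R) p :
  0 < h -> 1 <= lam ->
  (forall x, M x -> forall j, 0 <= x ord0 j - a j <= 2 * h * p%:R) ->
  (forall x, M x -> forall i, exists2 j, j != i &
     forall z, (z < p.+1)%N -> h <= `|lam * (x ord0 j - a j - 2 * h * z%:R)|) ->
  (linf_width n M <= h%:E)%E.
Proof.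
move=> h0 lam1 Mbox far.
pose phi (x : 'rV[R]_n.+1) : 'rV[R]_n.+1 :=
  \row_j (a j + crush h lam p (x ord0 j - a j)).
(* Bounds the coordinates of [phi x]: the shift, the position in the box, and the displacement
   [h]. *)
pose B := \sum_j `|a j| + (2 * h * p%:R + h).
have hp0 : 0 <= 2 * h * p%:R by rewrite !mulr_ge0// ltW.
have B0 : 0 < B by rewrite ltr_wpDl ?sumr_ge0// ltr_wpDl.
pose gv (j : 'I_n.+1) (c : 'I_p.+2) := a j + (h * p%:R + h * p.+1%:R - 2 * h * c%:R).
pose T : finType := ('I_n.+1 * 'I_n * 'I_p.+2 * 'I_p.+2)%type.
pose v (k : T) := flat_simplex B k.1.1.1 k.1.1.2
  (gv k.1.1.1 k.1.2) (gv (lift k.1.1.1 k.1.1.2) k.2).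
have phi_cont j :
    continuous (fun x : 'rV[R]_n.+1 => a j + crush h lam p (x ord0 j - a j)).
  have gc : continuous (fun y : R => a j + crush h lam p (y - a j)).
    move=> y; apply: cvgD; first exact: cvg_cst.
    apply: (@continuous_cvg _ _ _ _ _ _ (crush h lam p)).
      exact: crush_continuous.
    by apply: cvgB; [exact: cvg_id|exact: cvg_cst].
  move=> x; exact: (continuous_comp (@coord_continuous R 1 n.+1 ord0 j x) (gc _)).
have near x j : M x -> `|crush h lam p (x ord0 j - a j) - (x ord0 j - a j)| <= h.
  by move=> Mx; apply: crush_near => //; exact: Mbox.
apply: (@le_trans _ _ (ereal_sup [set (linf (x - phi x))%:E | x in M])).
  apply: ereal_inf_lbound; exists phi => //.
  exists (\bigcup_(k in [set: T]) simplex (v k)); split; first exact: polyhedron_finType.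
  split.
    by apply: continuous_subspaceT; exact: continuous_row phi_cont.
  move=> _ [x Mx <-].
  (* Using the hypothesis twice gives two distinct coordinates far from all centers. Both land on
     grid values, which puts [phi x] in one of finitely many flats of codimension two. *)
  have [j1 _ far1] := far x Mx ord0; have [j2 j21 far2] := far x Mx j1.
  case: (unliftP j1 j2) j21 far2 => [l0 -> _ far2|-> /eqP//].
  have [c1 c1p E1] := crush_grid h0 far1; have [c2 c2p E2] := crush_grid h0 far2.
  exists (j1, l0, Ordinal c1p, Ordinal c2p) => //.
  rewrite /v/= /gv/= -E1 -E2.
  have := @mem_flat_simplex n B j1 l0 (phi x) B0; rewrite !mxE; apply.
  move=> j; rewrite mxE /B (bigD1 j)//=; have := near x j Mx; have := Mbox x Mx j.
  have : 0 <= \sum_(i < n.+1 | i != j) `|a i| by rewrite sumr_ge0.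
  move: (\sum_(i < n.+1 | i != j) `|a i|) (crush _ _ _ _) => S C.
  rewrite !ler_norml; case: (ger0P (a j)); lra.
apply: ge_ereal_sup => _ [x Mx <-]; rewrite lee_fin.
apply: bigmax_le => [|j _]; first exact: ltW.
rewrite !mxE; have := near x j Mx; rewrite -normrN; congr (_ <= _).
by congr `| _ |; ring.
Qed.

End Width.

(** * From Hausdorff measure to finite covers by balls *)

Section BallCover.
Variable R : realType.

Definition sqdist N (x y : 'rV[R]_N) : R := \sum_(i < N) (x ord0 i - y ord0 i) ^+ 2.

Lemma sqdist_ge0 N (x y : 'rV[R]_N) : 0 <= sqdist x y.
Proof. by apply: sumr_ge0 => i _; exact: sqr_ge0. Qed.

Lemma sqdist_coord N (x y : 'rV[R]_N) i : (x ord0 i - y ord0 i) ^+ 2 <= sqdist x y.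
Proof.
by rewrite /sqdist (bigD1 i)//= lerDl; apply: sumr_ge0 => j _; exact: sqr_ge0.
Qed.

Lemma sqdist_coord_norm N (x y : 'rV[R]_N) (v : R) i :
  sqdist x y <= v -> `|x ord0 i - y ord0 i| <= v + 1.
Proof.
move=> xyv; have := le_trans (sqdist_coord x y i) xyv.
rewrite -real_normK ?num_real//; have := normr_ge0 (x ord0 i - y ord0 i).
move: (`|_|) => u u0 uv; have := sqr_ge0 (u - 1); rewrite sqrrB expr1n mulr1.
rewrite -mulr_natl; lra.
Qed.

Lemma sqdist_mid N (p x y : 'rV[R]_N) :
  sqdist p (2^-1 *: (x + y)) = (sqdist p x + sqdist p y) / 2 - sqdist x y / 4.
Proof.
rewrite /sqdist -big_split/= !mulr_suml -sumrB; apply: eq_bigr => i _.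
by rewrite !mxE; field.
Qed.

Lemma ediam_ge0 N (U : set 'rV[R]_N) : (0 <= ediam U)%E.
Proof. by apply: ereal_sup_ubound; right. Qed.

(* A weak form of Jung's theorem: by the parallelogram law the midpoint of two
   points realizing the diameter is the center. *)
Lemma diam_in_ball N n (U : set 'rV[R]_N) (d e : R) : ediam U = d%:E -> 0 < e ->
  exists c (v w : R), [/\ 0 <= v, v < w, forall p, U p -> sqdist p c <= v &
    Num.sqrt w ^+ n <= Num.sqrt 3 ^+ n * (d / 2) ^+ n + e].
Proof.
move=> Ud e0; have d0 : 0 <= d by rewrite -lee_fin -Ud ediam_ge0.
have dist_le x y : U x -> U y -> sqdist x y <= d ^+ 2.
  move=> Ux Uy; have : ((Defs.edist x y)%:E <= ediam U)%E.
    by apply: ereal_sup_ubound; left; exists x => //; exists y.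
  rewrite Ud lee_fin => xyd.
  rewrite -[sqdist x y]sqr_sqrtr ?sqdist_ge0// lerXn2r ?nnegrE ?sqrtr_ge0//.
(* The squared median [d^2 - d^2/4] of an equilateral triangle of side [d]. As the diameter need not
   be attained, the ball gets a slightly larger squared radius [v]. *)
pose w0 : R := 3 * (d / 2) ^+ 2.
have w00 : 0 <= w0 by rewrite mulr_ge0// sqr_ge0.
have w0E : Num.sqrt w0 ^+ n = Num.sqrt 3 ^+ n * (d / 2) ^+ n.
  by rewrite sqrtrM// sqrtr_sqr ger0_norm ?divr_ge0// exprMn.
have [w [w0w wE]] : exists w, w0 < w /\ Num.sqrt w ^+ n < Num.sqrt w0 ^+ n + e.
  have cont : (fun w : R => Num.sqrt w ^+ n) @ w0 --> Num.sqrt w0 ^+ n.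
    exact: (continuous_comp (@sqrt_continuous R w0) (@exprn_continuous R n _)).
  have nb' : \forall w \near w0^'+, Num.sqrt w ^+ n < Num.sqrt w0 ^+ n + e.
    apply: (cvg_at_right_filter cont (t := [set y : R | y < Num.sqrt w0 ^+ n + e])).
    by apply: lt_nbhsl; rewrite ltrDl.
  near (w0^'+) => w; exists w; split; near: w; [exact: nbhs_right_gt|exact: nb'].
rewrite w0E in wE.
pose v := (w0 + w) / 2.
have vw : v < w by rewrite /v; lra.
have w0v : w0 < v by rewrite /v; lra.
have v0 : 0 <= v by lra.
suff [c Uc] : exists c, forall p, U p -> sqdist p c <= v.
  by exists c, v, w; split=> //; exact: ltW.
have [[x0 Ux0]|noU] := pselect (exists x, U x); last first.
  by exists 0 => p Up; exfalso; apply: noU; exists p.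
have [dv|vd] := leP (d ^+ 2) v.
  by exists x0 => p Up; exact: le_trans (dist_le _ _ Up Ux0) dv.
(* Two points further apart than this have a midpoint within [v] of all of [U]; such points exist
   because [v > 3 d^2 / 4]. *)
have : ((Num.sqrt (4 * (d ^+ 2 - v)))%:E < ediam U)%E.
  rewrite Ud lte_fin -[ltRHS]ger0_norm// -sqrtr_sqr ltr_sqrt; last first.
    by apply: le_lt_trans vd.
  by move: w0v; rewrite /w0; lra.
move=> /ereal_sup_gt[_ [[x Ux [y Uy <-]]|->]]; rewrite lte_fin; last first.
  by move=> h; have := le_lt_trans (sqrtr_ge0 _) h; rewrite ltxx.
rewrite /Defs.edist -/(sqdist x y) => xy.
have xy4 : 4 * (d ^+ 2 - v) < sqdist x y.
  rewrite -ltr_sqrt//; have := le_lt_trans (sqrtr_ge0 _) xy.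
  by rewrite sqrtr_gt0.
exists (2^-1 *: (x + y)) => p Up; rewrite sqdist_mid.
by have := dist_le _ _ Up Ux; have := dist_le _ _ Up Uy; lra.
Unshelve. all: by end_near. Qed.

Lemma continuous_sum_real (T : topologicalType) n (f : 'I_n -> T -> R) :
  (forall i, continuous (f i)) -> continuous (fun x => \sum_i f i x).
Proof.
move=> fc x; apply: cvg_big => [|i _]; [exact: add_continuous|exact: fc].
Qed.

Lemma open_sqball N (c : 'rV[R]_N) (v : R) : open [set p | sqdist p c < v].
Proof.
have cont : continuous (fun p : 'rV[R]_N => sqdist p c).
  apply: continuous_sum_real => i p.
  have sc : continuous (fun y : R => (y - c ord0 i) ^+ 2).
    move=> y; apply: (@continuous_cvg _ _ _ _ _ _ (fun y : R => y ^+ 2)).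
      exact: exprn_continuous.
    by apply: cvgB; [exact: cvg_id|exact: cvg_cst].
  exact: (continuous_comp (@coord_continuous R 1 N ord0 i p) (sc _)).
have -> : [set p | sqdist p c < v] = (fun p => sqdist p c) @^-1` [set y | y < v] by [].
by apply: open_comp => [p _|]; [exact: cont|exact: open_lt].
Qed.

Lemma hausdorff_finite_ball_cover N n (M : set 'rV[R]_N) (X e : R) :
  compact M -> hausdorff_measure n M = X%:E -> 0 < e ->
  exists l : seq ('rV[R]_N * R * R),
    [/\ forall k, k \in l -> 0 <= k.1.2 < k.2,
        forall p, M p -> exists2 k, k \in l & sqdist p k.1.1 <= k.1.2 &
        \sum_(k <- l) unit_ball_vol R n * Num.sqrt k.2 ^+ n <= Num.sqrt 3 ^+ n * X + e].
Proof.
move=> cM MX e0.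
have om0 := unit_ball_vol_ge0 R n; set om := unit_ball_vol R n in om0 *.
have s30 : 0 <= Num.sqrt 3 ^+ n :> R by rewrite exprn_ge0// sqrtr_ge0.
pose s3 : R := Num.sqrt 3 ^+ n; rewrite -/s3 in s30 *.
(* Each error contributes at most [e / 2] after multiplication by [s3] or [om]; the [+ 1] keeps the
   denominators positive. *)
pose e1 := e / 2 / (s3 + 1); pose e2 := e / 2 / (om + 1).
have e10 : 0 < e1 by rewrite !divr_gt0// ltr_wpDl.
have e20 : 0 < e2 by rewrite !divr_gt0// ltr_wpDl.
have : (hausdorff_approx n 1 M < (X + e1)%:E)%E.
  apply: (@le_lt_trans _ _ X%:E); last by rewrite lte_fin ltrDl.
  by rewrite -MX; apply: ereal_sup_ubound; exists 1 => //=.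
move=> /ereal_inf_lt[_ [U [MU U1] <-] sumU].
have [d dE] : exists d : nat -> R, forall i, ediam (U i) = (d i)%:E.
  exists (fun i => fine (ediam (U i))) => i; rewrite fineK// ge0_fin_numE ?ediam_ge0//.
  exact: le_lt_trans (U1 i) (ltry _).
have d0 i : 0 <= d i by rewrite -lee_fin -dE ediam_ge0.
have ball i := @diam_in_ball N n (U i) (d i) (e2 / 2 ^+ i.+1) (dE i)
  (divr_gt0 e20 (exprn_gt0 _ (ltr0n _ 2))).
(* Open balls of squared radius midway between [v] and [w] contain the sets [U i], allow a finite
   subcover, and still leave a gap below [w]. *)
have [c /choice[v /choice[w bP]]] := choice ball.
pose O i := [set p | sqdist p (c i) < (v i + w i) / 2].
have vw i : v i < (v i + w i) / 2 < w i by have [_ h _ _] := bP i; lra.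
have [D _ MD] : finite_subset_cover setT O M.
  move: cM; rewrite compact_cover; apply => [i _|p /MU[i _ Uip]]; first exact: open_sqball.
  exists i => //; have [_ _ /(_ p Uip) h _] := bP i; apply: le_lt_trans h _.
  by have /andP[] := vw i.
have [K DK] : exists K : nat, forall i : nat, [set` D] i -> (i < K)%N.
  exists (\max_(i <- enum_fset D) i).+1 => i iD; rewrite ltnS; exact: leq_bigmax_seq.
exists [seq (c i, (v i + w i) / 2, w i) | i <- index_iota 0 K]; split.
- move=> k /mapP[i _ ->] /=; have := vw i; have [] := bP i; lra.
- move=> p /MD[i iD Op]; exists (c i, (v i + w i) / 2, w i); last exact: ltW.
  by apply/mapP; exists i => //; rewrite mem_index_iota DK.
rewrite big_map/=.
have S1 : \sum_(0 <= i < K) om * (d i / 2) ^+ n <= X + e1.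
  rewrite -lee_fin; apply: le_trans (ltW sumU).
  apply: (@le_trans _ _ (\sum_(0 <= i < K) om%:E * (ediam (U i) * (2^-1)%:E) ^+ n)%E).
    rewrite -sumEFin; apply: lee_sum => i _.
    by rewrite dE -EFinM -EFin_expe -EFinM.
  apply: nneseries_lim_ge => i _ _.
  by rewrite mule_ge0// expe_ge0// mule_ge0// ?ediam_ge0// lee_fin.
have S2 : \sum_(0 <= i < K) e2 / 2 ^+ i.+1 <= e2.
  have -> : \sum_(0 <= i < K) e2 / 2 ^+ i.+1 = e2 * (1 - 2^-1 ^+ K).
    elim: K {DK S1} => [|K IH]; first by rewrite big_geq// expr0 subrr mulr0.
    by rewrite big_nat_recr//= IH -exprVn exprS; field.
  by rewrite ger_pMr// lerBlDr lerDl exprn_ge0.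
apply: (@le_trans _ _ (\sum_(0 <= i < K) (s3 * (om * (d i / 2) ^+ n) + om * (e2 / 2 ^+ i.+1)))).
  apply: ler_sum => i _; have [_ _ _ h] := bP i.
  by apply: le_trans (ler_wpM2l om0 h) _; rewrite mulrDr mulrCA.
rewrite big_split/= -mulr_sumr -[X in _ + X]mulr_sumr.
apply: (@le_trans _ _ (s3 * (X + e1) + om * e2)).
  by apply: lerD; apply: ler_wpM2l.
have h1 : s3 * e1 <= e / 2.
  rewrite /e1 mulrCA ler_piMr ?divr_ge0 ?(ltW e0)// ler_pdivrMr ?ltr_wpDl//.
  by rewrite mul1r lerDl.
have h2 : om * e2 <= e / 2.
  rewrite /e2 mulrCA ler_piMr ?divr_ge0 ?(ltW e0)// ler_pdivrMr ?ltr_wpDl//.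
  by rewrite mul1r lerDl.
by rewrite mulrDr; lra.
Qed.

End BallCover.

(** * Perturbation of the centers, the constant 3, and the final estimate *)

Section Assembly.
Variable R : realType.

Lemma uniform_margin (I : eqType) (l : seq I) (f g : I -> R) (h : R) : 0 < h ->
  (forall k, k \in l -> 0 <= f k /\ 0 < g k) ->
  exists eta, [/\ 0 < eta, eta <= h & forall k, k \in l -> f k * eta < g k].
Proof.
move=> h0; elim: l => [|k l IH] fg; first by exists h.
have [|eta [eta0 etah P]] := IH.
  by move=> i il; apply: fg; rewrite inE il orbT.
have [f0 g0] := fg k (mem_head _ _).
have f1 : 0 < f k + 1 by rewrite ltr_wpDl.
have q0 : 0 < g k / (f k + 1) by rewrite divr_gt0.
exists (Num.min eta (g k / (f k + 1))); split.
- by rewrite lt_min eta0.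
- by rewrite ge_min etah.
move=> i; rewrite inE => /orP[/eqP ->|il].
  apply: (@le_lt_trans _ _ (f k * (g k / (f k + 1)))).
    by rewrite ler_wpM2l// ge_min lexx orbT.
  by rewrite mulrCA gtr_pMr// ltr_pdivrMr// mul1r ltrDl.
apply: le_lt_trans (P i il); rewrite ler_wpM2l ?ge_min ?lexx//.
by have [] := fg i; rewrite ?inE ?il ?orbT.
Qed.

Lemma count_neq_ord n (i : 'I_n.+1) : count (fun j => j != i :> nat) (iota 0 n.+1) = n.
Proof.
have := count_predC (pred1 (i : nat)) (iota 0 n.+1).
rewrite size_iota count_uniq_mem ?iota_uniq// mem_iota/= add0n ltn_ord.
by rewrite add1n => -[].
Qed.

Lemma sum_sqr_perturb n (P : pred 'I_n.+1) (f g : 'I_n.+1 -> R) (eta b : R) :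
  0 < eta -> eta <= 1 -> (forall j, `|f j| <= b) -> (forall j, P j -> `|g j| <= eta) ->
  \sum_(j | P j) (f j - g j) ^+ 2 <= \sum_j (f j) ^+ 2 + n.+1%:R * (2 * b + 1) * eta.
Proof.
move=> eta0 eta1 fb geta.
apply: (@le_trans _ _ (\sum_j (f j ^+ 2 + (2 * b + 1) * eta))); last first.
  by rewrite big_split/= sumr_const card_ord -[_ *+ _]mulr_natl mulrA.
rewrite big_mkcond; apply: ler_sum => j _; have b0 := le_trans (normr_ge0 _) (fb j).
case: ifP => [Pj|_]; last by rewrite addr_ge0 ?sqr_ge0// mulr_ge0 ?(ltW eta0)//; lra.
have -> : (f j - g j) ^+ 2 = f j ^+ 2 + (- (2 * (f j * g j)) + g j ^+ 2) by ring.
rewrite lerD2l [(2 * b + 1) * eta]mulrDl mul1r; apply: lerD.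
  apply: (le_trans (ler_norm _)); rewrite normrN normrM ger0_norm// -mulrA ler_wpM2l//.
  by rewrite normrM ler_pM// geta.
rewrite -real_normK ?num_real// expr2 -[leRHS]mulr1.
by rewrite ler_pM// ?geta// (le_trans (geta j Pj)).
Qed.

(** Every ball yields [n+1] cylinders, one per coordinate direction, of total potential below 1. A
    point of [M] near a center line of the shifted lattice would make the shift hit one of them. *)
Lemma linf_width_le_ball_cover n (M : set 'rV[R]_n.+1) (r : R)
    (l : seq ('rV[R]_n.+1 * R * R)) : 0 < r ->
  (forall k, k \in l -> 0 <= k.1.2 < k.2) ->
  (forall p, M p -> exists2 k, k \in l & sqdist p k.1.1 <= k.1.2) ->
  n.+1%:R * (\sum_(k <- l) unit_ball_vol R n * Num.sqrt k.2 ^+ n) < r ^+ n ->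
  (linf_width n M <= (r / 2)%:E)%E.
Proof.
move=> r0 lvw cover small.
pose b := \sum_(k <- l) (\sum_j `|k.1.1 ord0 j| + (k.1.2 + 1)).
have term0 k : k \in l -> 0 <= \sum_j `|k.1.1 ord0 j| + (k.1.2 + 1).
  by move=> /lvw/andP[v0 _]; rewrite addr_ge0 ?sumr_ge0// addr_ge0.
have Mb x j : M x -> `|x ord0 j| <= b.
  move=> /cover[k kl xk]; rewrite /b (big_rem k)//=.
  have rest0 : 0 <= \sum_(y <- rem k l) (\sum_j `|y.1.1 ord0 j| + (y.1.2 + 1)).
    by rewrite big_seq sumr_ge0// => i /mem_rem; exact: term0.
  rewrite -[leLHS]addr0; apply: lerD => //.
  have := sqdist_coord_norm j xk; rewrite (bigD1 j)//=.
  have : 0 <= \sum_(i < n.+1 | i != j) `|k.1.1 ord0 i| by rewrite sumr_ge0.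
  have := ler_normD (x ord0 j - k.1.1 ord0 j) (k.1.1 ord0 j); rewrite subrK.
  lra.
(* Shifts in [[-b - r, -b]] lie to the left of [M], so the differences [x - a] lie in [[0, 2b + r]],
   which [p] periods cover. *)
pose A := - b - r.
pose p := (Num.trunc (2 * b / r + 1)).+1.
have b0 : 0 <= b by rewrite /b big_seq sumr_ge0.
have pE : 2 * b + r <= r * p%:R.
  have := ltW (truncnS_gt (2 * b / r + 1)); rewrite -/p -(ler_pM2l r0) => h.
  by apply: le_trans h; rewrite mulrDr mulr1 mulrCA divff ?gt_eqF// mulr1.
pose cyl (k : 'rV[R]_n.+1 * R * R) (i : 'I_n.+1) : cylinder R :=
  (fun j => k.1.1 ord0 (inord j), k.2, fun j => j != i :> nat).
have [|a [aA av]] := @exists_avoiding_shift R r A p.+1 r0 n.+1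
    [seq cyl k i | k <- l, i <- enum 'I_n.+1].
  rewrite big_allpairs_dep.
  apply: (@le_lt_trans _ _ (\sum_(k <- l) \sum_(i <- enum 'I_n.+1)
      (unit_ball_vol R n * Num.sqrt k.2 ^+ n / r ^+ n))).
    apply: ler_sum => k _; apply: ler_sum => i _.
    have -> : count (cyl k i).2 (iota 0 n.+1) = n := count_neq_ord i.
    rewrite /potential/= -mulrA ler_piMl ?lern1 ?leq_b1//.
    by rewrite divr_ge0 ?mulr_ge0 ?unit_ball_vol_ge0 ?exprn_ge0 ?sqrtr_ge0// ltW.
  under eq_bigr do rewrite big_const_seq count_predT size_enum_ord iter_addr_0.
  by rewrite sumrMnl -mulr_suml -mulr_natl mulrA ltr_pdivrMr ?exprn_gt0// mul1r.
(* Moving a point by [eta] in each coordinate changes its squared distance to a center by less than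
   the gap between the two squared radii. *)
have [eta [eta0 etah margin]] :
    exists eta, [/\ 0 < eta, eta <= Num.min 1 (r / 2) & forall k, k \in l ->
      n.+1%:R * (2 * (k.1.2 + 1) + 1) * eta < k.2 - k.1.2].
  apply: uniform_margin; first by rewrite lt_min ltr01 divr_gt0.
  move=> k /lvw/andP[v0 vw]; split; last by rewrite subr_gt0.
  by rewrite mulr_ge0//; lra.
move: etah; rewrite le_min => /andP[eta1 etah].
have h0 : 0 < r / 2 by rewrite divr_gt0.
have h2 : 2 * (r / 2) = r by field.
(* This factor expands the distance [eta] from a center to the half mesh [r / 2]. *)
apply: (@linf_width_le_shift R n M (r / 2) (r / 2 / eta) (fun j => a j) p) => //.
- by rewrite ler_pdivlMr// mul1r.
- move=> x Mx j; rewrite h2; have := Mb x j Mx; have := aA j; rewrite /A ler_norml.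
  by move: pE; lra.
move=> x Mx i; apply: contrapT => noj.
have [k kl xk] := cover x Mx.
(* Failure in direction [i] puts every other coordinate within [eta] of a center; the value 0 for
   the remaining indices is a dummy. *)
have close : forall j : nat, exists z, (z < p.+1)%N /\ (j != i :> nat -> (j < n.+1)%N ->
    `|x ord0 (inord j) - a j - r * z%:R| <= eta).
  move=> j; apply: contrapT => far; apply: noj.
  have [ji|ji] := eqVneq j (i : nat).
    by exfalso; apply: far; exists 0%N; split=> //; rewrite ji eqxx.
  have [jn|jn] := ltnP j n.+1; last first.
    by exfalso; apply: far; exists 0%N; split=> // _; rewrite ltnNge jn.
  exists (inord j); first by apply: contraNneq ji => <-; rewrite inordK.
  move=> z zp; rewrite h2 inordK// leNgt; apply/negP => lt; apply: far; exists z; split=> // _ _.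
  move: lt; rewrite normrM ger0_norm ?divr_ge0 ?(ltW r0) ?(ltW eta0)//.
  rewrite mulrAC ltr_pdivrMr// ltr_pM2l// => /ltW //.
have [z zP] := choice close.
have := av (cyl k i); rewrite /cyl/= => /(_ _ z (fun j => (zP j).1)).
have mem : (fun j => k.1.1 ord0 (inord j), k.2, fun j : nat => j != i) \in
    [seq cyl k i | k <- l, i <- enum 'I_n.+1].
  by apply: (allpairs_f cyl kl); rewrite mem_enum.
move=> /(_ mem); apply/negP; rewrite -ltNge.
have E : \sum_(j < n.+1 | (j != i :> nat)) (a j + r * (z j)%:R - k.1.1 ord0 (inord j)) ^+ 2 =
    \sum_(j < n.+1 | (j != i :> nat)) ((x ord0 j - k.1.1 ord0 j) -
       (x ord0 j - a j - r * (z j)%:R)) ^+ 2.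
  by apply: eq_bigr => j _; rewrite inord_val; congr (_ ^+ 2); ring.
rewrite E; apply: le_lt_trans (sum_sqr_perturb (b := k.1.2 + 1) eta0 eta1 _ _) _.
- by move=> j; exact: sqdist_coord_norm.
- by move=> j ji; have := (zP j).2 ji (ltn_ord j); rewrite inord_val.
have := margin k kl; rewrite -/(sqdist x k.1.1); lra.
Qed.

(** The sequence [(n+1)^2 (3/4)^n] decreases from [n = 6] on, where it is about 8.72; smaller cases
    are computed. *)
Lemma sqr_succ_exp3_le n : (n.+1 ^ 2 * 3 ^ n <= 9 * 4 ^ n)%N.
Proof.
have [n6|n6] := ltnP n 6; first by do 6 (case: n n6 => [//|n] n6).
rewrite -(subnK n6); elim: (n - 6)%N => [|m IH]; first by vm_compute.
rewrite addSn !(expnS _ (m + 6)); move: IH; set u := (3 ^ _)%N; set v := (4 ^ _)%N.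
nia.
Qed.

Lemma succ_sqrt3_exp_le n : n.+1%:R * Num.sqrt 3 ^+ n <= 3 * 2 ^+ n :> R.
Proof.
rewrite -(@ler_pXn2r _ 2) ?nnegrE ?mulr_ge0 ?exprn_ge0 ?sqrtr_ge0//.
rewrite !exprMn -!exprM ![(n * 2)%N]mulnC !exprM sqr_sqrtr//.
by rewrite -!natrX -!natrM ler_nat; exact: sqr_succ_exp3_le.
Qed.

Lemma exprD_ge_sum (x y : R) n : 0 <= x -> 0 <= y -> (0 < n)%N ->
  x ^+ n + y ^+ n <= (x + y) ^+ n.
Proof.
move=> x0 y0; case: n => [//|n] _; elim: n => [|n IH]; first by rewrite !expr1.
rewrite !(exprS _ n.+1); apply: le_trans (ler_wpM2l (addr_ge0 x0 y0) IH).
rewrite mulrDl !mulrDr -addrA lerD2l addrA lerDr.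
by rewrite addr_ge0// mulr_ge0// exprn_ge0.
Qed.

Lemma linf_width_compact n (M : set 'rV[R]_n.+1) (X : R) : (0 < n)%N -> compact M ->
  hausdorff_measure n M = X%:E -> 0 <= X ->
  (linf_width n M <= ((3 * X) `^ n%:R^-1)%:E)%E.
Proof.
move=> n0 cM MX X0; apply/lee_addgt0Pr => e e0; rewrite -EFinD.
set y := (3 * X) `^ n%:R^-1; have y0 : 0 <= y by exact: powR_ge0.
have yn : y ^+ n = 3 * X.
  by rewrite -powR_mulrn// -powRrM mulVf ?powRr1 ?mulr_ge0// pnatr_eq0 -lt0n.
have en0 : 0 < e ^+ n by rewrite exprn_gt0.
(* Multiplied by [n+1] this error is [e^n / 2], strictly below the [2^n e^n] that superadditivity of
   the power leaves in [(2 (y + e))^n]. *)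
have d0 : 0 < e ^+ n / (2 * n.+1%:R) by rewrite divr_gt0// mulr_gt0// ltr0n.
have [l [lvw cover small]] := hausdorff_finite_ball_cover cM MX d0.
have r0 : 0 < 2 * (y + e) by rewrite mulr_gt0// ltr_wpDl.
have := linf_width_le_ball_cover r0 lvw cover.
have -> : 2 * (y + e) / 2 = y + e by field.
apply; apply: (le_lt_trans (ler_wpM2l (ler0n _ _) small)).
have ye : y ^+ n + e ^+ n <= (y + e) ^+ n. by exact: exprD_ge_sum y0 (ltW e0) n0.
rewrite mulrDr mulrA exprMn.
have h1 := succ_sqrt3_exp_le n.
have h2 : n.+1%:R * Num.sqrt 3 ^+ n * X <= 2 ^+ n * y ^+ n.
  by rewrite yn mulrA [2 ^+ n * 3]mulrC ler_wpM2r.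
have h3 : n.+1%:R * (e ^+ n / (2 * n.+1%:R)) = e ^+ n / 2.
  have : n.+1%:R != 0 :> R by rewrite pnatr_eq0.
  by move: n.+1%:R => u u0; field.
have h4 : e ^+ n / 2 < 2 ^+ n * e ^+ n.
  have : 1 <= 2 ^+ n :> R by rewrite exprn_ege1// ler1n.
  move=> /(ler_wpM2r (ltW en0)); lra.
rewrite h3; apply: (lt_le_trans (ler_ltD h2 h4)).
by rewrite -mulrDr ler_wpM2l// exprn_ge0.
Qed.

End Assembly.

Lemma hausdorff_measure_ge0 (R : realType) N n (M : set 'rV[R]_N) :
  (0 <= hausdorff_measure n M)%E.
Proof.
apply: (@le_trans _ _ (hausdorff_approx n 1 M)); last first.
  by apply: ereal_sup_ubound; exists 1 => //=.
apply: le_ereal_inf_tmp => _ [U _ <-]; apply: nneseries_ge0 => i _ _.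
by rewrite mule_ge0// ?lee_fin ?unit_ball_vol_ge0// expe_ge0// mule_ge0 ?ediam_ge0// lee_fin.
Qed.

Theorem theorem1p2 (R : realType) (n : nat) (M : set 'rV[R]_n.+1) :
  (0 < n)%N -> closed_hypersurface M ->
  let vol := hausdorff_measure n M in
  (linf_width n M <= ((3 : R) `^ (n%:R^-1))%:E * (vol `^ (n%:R^-1))%E
   /\ ((3 : R) `^ (n%:R^-1))%:E * (vol `^ (n%:R^-1))%E
      <= 3%:E * (vol `^ (n%:R^-1))%E)%E.
Proof.
move=> n0 [cM _] vol; split; last first.
  rewrite lee_wpmul2r ?poweR_ge0// lee_fin -[leRHS]powRr1//.
  by rewrite ler_powR ?ler1n// invf_le1 ?ler1n// ltr0n.
have n_neq0 : n%:R^-1 != 0 :> R by rewrite invr_eq0 pnatr_eq0 -lt0n.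
(* For infinite volume the right-hand side is infinite. *)
have /gee0P[volE|[X X0 volE]] := hausdorff_measure_ge0 n M; rewrite /vol volE.
  by rewrite poweRyr// gt0_muley ?leey// lte_fin powR_gt0.
rewrite poweR_EFin -EFinM -powRM//; exact: linf_width_compact.
Qed.
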